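(* Let $Q$ be a symmetric quiver on $v$ vertices, with mutation sequence $1,\dots,v,1,\dots,v,\dots$, and let $n\ge1$. Let $\mathcal W$ be the set of (possibly empty) sequences $\mathbf w=(w_1,\dots,w_k)$ of integers with $1\le w_1\le\cdots\le w_k\le n$. Then $$F_n=\sum_{\mathbf w\in\mathcal W}\phi(\mathbf w)\prod_{i=1}^k\Big(s_{n-w_i}+\sum_{j=i+1}^k\big(-s_{w_j-w_i}+s'_{w_j-w_i}\big)\Big)\prod_{i=1}^v y_i^{\sum_{j=1}^k s_{w_j-i}}.$$
   Context: A quiver is a finite directed multigraph on vertices $1,\dots,v$ without loops or 2-cycles. Mutation at $k$: for every path $i\to k\to j$ add an arrow $i\to j$, reverse all arrows incident to $k$, then delete all 2-cycles. The framed quiver has additional frozen vertices $1',\dots,v'$ with one arrow $i'\to i$ each; only base vertices are mutated. Initially each base vertex has label $1$ and $i'$ has label $y_i$; mutating at $k$ replaces the label $V_k$ by (product of labels over arrows into $k$ + product of labels over arrows out of $k$, with multiplicity)$/V_k$. For a mutation sequence $v_1,v_2,\dots$, the $F$-polynomial $F_n$ is the label at $v_n$ after the $n$-th mutation. The $i$-th mutation is green if just before it all arrows between frozen vertices and $v_i$ point into $v_i$. Let $N(i\to j)$ be the number of arrows $i\to j$ in the base quiver $Q$. $Q$ is a symmetric quiver if: (1) reversing all arrows and relabeling $i$ as $v+1-i$ returns the same quiver; (2) mutating $Q$ at $1$ and relabeling $i$ as $i-1$ (with $1$ relabeled $v$) returns $Q$; (3) $N(1\to i)=N(1\to v+2-i)$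 and $N(i\to1)=N(v+2-i\to1)$ for $2\le i\le v$; (4) every mutation in the sequence $1,\dots,v,1,\dots,v,\dots$ is green. Sequences: $s_m=0$ for $m<0$, $s_0=1$, and $s_m=-s_{m-v}+\sum_{i=2}^v N(1\to i)\,s_{m-v+i-1}$ for $m\ge1$; $s'_m=-s_{m-v}+\sum_{i=2}^vN(i\to1)\,s_{m-v+i-1}$ for $m\ge 0$. $\phi(\mathbf w)$ is the number of distinct permutations of $w_1,\dots,w_k$ divided by $k!$ (so $\phi=1$ for the empty sequence, whose products are $1$). The sum is taken coefficientwise as a formal power series in $y_1,\dots,y_v$. *)

(* Defs.v *)
From HB Require Import structures.
From mathcomp Require Import all_boot all_order all_algebra.
From mathcomp Require Import fraction zify.
From mathcomp.multinomials Require Import mpoly.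

Set Implicit Arguments.
Unset Strict Implicit.
Unset Printing Implicit Defensive.

Import Order.TTheory GRing.Theory Num.Theory.

Local Open Scope ring_scope.

(* Vertices are numbered from 0: i : 'I_v stands for the vertex i + 1 in       *)
(* {1, ..., v}.  The terms of a sequence w and the index n are 1-based.       *)

(** * Quivers and mutation *)

(* [Q i j] is the number of arrows i -> j. *)
Definition arrows (T : finType) := T -> T -> nat.

Definition is_quiver (T : finType) (Q : arrows T) : Prop :=
  (forall i, Q i i = 0%N) /\ (forall i j, Q i j = 0%N \/ Q j i = 0%N).

(* The case k \in {i, j} is the reversal of the arrows at k.  Truncated       *)
(* subtraction in [cancel2] removes a maximal set of disjoint 2-cycles.       *)
Definition mutate_arrows (T : finType) (k : T) (Q : arrows T) : arrows T :=
  fun i j => if (i == k) || (j == k) then Q j i else (Q i j + Q i k * Q k j)%N.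

Definition cancel2 (T : finType) (Q : arrows T) : arrows T :=
  fun i j => (Q i j - Q j i)%N.

Definition mutate (T : finType) (k : T) (Q : arrows T) : arrows T :=
  cancel2 (mutate_arrows k Q).

(* [inl i] is the base vertex i and [inr i] is the frozen vertex i'. *)
Definition framed (v : nat) (N : arrows 'I_v) : arrows ('I_v + 'I_v)%type :=
  fun a b => match a, b with
             | inl i, inl j => N i j
             | inr i, inl j => (i == j)%N
             | _, inr _ => 0%N
             end.

(* The vertex v_{t+1} of the sequence 1, ..., v, 1, ..., v, ... *)
Definition mutvertex (v : nat) (hv : (0 < v)%N) (t : nat) : 'I_v :=
  Ordinal (ltn_pmod t hv).

(* The framed quiver after the first t mutations. *)
Fixpoint quiver_at (v : nat) (hv : (0 < v)%N) (N : arrows 'I_v) (t : nat) :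
    arrows ('I_v + 'I_v)%type :=
  if t is t'.+1 then mutate (inl (mutvertex hv t')) (quiver_at hv N t')
  else framed N.

Definition green (v : nat) (Q : arrows ('I_v + 'I_v)%type) (k : 'I_v) : Prop :=
  forall i : 'I_v, Q (inl k) (inr i) = 0%N.

(** * Labels and F-polynomials *)

(* Labels are rational functions in y_1, ..., y_v; ['X_i] is y_{i+1}. *)
Definition ratfun (v : nat) := {fraction {mpoly rat[v]}}.

Definition initial_label (v : nat) (a : 'I_v + 'I_v) : ratfun v :=
  match a with
  | inl _ => 1
  | inr i => tofrac ('X_i : {mpoly rat[v]})
  end.

Definition mutate_label (v : nat) (k : 'I_v + 'I_v)
    (Q : arrows ('I_v + 'I_v)%type) (V : 'I_v + 'I_v -> ratfun v) :
    'I_v + 'I_v -> ratfun v :=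
  fun x => if x == k
           then (\prod_a V a ^+ Q a k + \prod_a V a ^+ Q k a) / V k
           else V x.

Fixpoint label_at (v : nat) (hv : (0 < v)%N) (N : arrows 'I_v) (t : nat) :
    'I_v + 'I_v -> ratfun v :=
  if t is t'.+1
  then mutate_label (inl (mutvertex hv t')) (quiver_at hv N t')
                    (label_at hv N t')
  else @initial_label v.

(* Meaningful for n >= 1. *)
Definition Fpoly (v : nat) (hv : (0 < v)%N) (N : arrows 'I_v) (n : nat) :
    ratfun v :=
  label_at hv N n (inl (mutvertex hv n.-1)).

(** * Symmetric quivers *)

(* [ord_pred] sends 0 to v - 1.  In the third condition, i + j = v with       *)
(* 0-based i, j < v says that the 1-based vertices are i' and v + 2 - i' with *)
(* 2 <= i' <= v.                                                              *)
Record symmetric_quiver (v : nat) (hv : (0 < v)%N) (N : arrows 'I_v) : Prop :=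
  SymmetricQuiver {
    sq_quiver : is_quiver N;
    sq_reverse : forall i j, N (rev_ord i) (rev_ord j) = N j i;
    sq_rotate : forall i j,
      N (ord_pred i) (ord_pred j) = mutate (Ordinal hv) N i j;
    sq_first : forall i j : 'I_v, (i + j)%N = v ->
      N (Ordinal hv) i = N (Ordinal hv) j /\ N i (Ordinal hv) = N j (Ordinal hv);
    sq_green : forall t, green (quiver_at hv N t) (mutvertex hv t)
  }.

(** * The sequences s and s' *)

(* [fuel] bounds the depth of the recursion; see [s_rec]. *)
Fixpoint s_fuel (v : nat) (hv : (0 < v)%N) (N : arrows 'I_v) (fuel : nat)
    (m : int) : int :=
  if m < 0 then 0
  else if m == 0 then 1
  else if fuel is fuel'.+1 then
    - s_fuel hv N fuel' (m - v%:Z)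
    + \sum_(i < v | (0 < i)%N)
        (N (Ordinal hv) i)%:Z * s_fuel hv N fuel' (m - v%:Z + i%:Z)
  else 0.

Definition s (v : nat) (hv : (0 < v)%N) (N : arrows 'I_v) (m : int) : int :=
  s_fuel hv N `|m|%N m.

(* Used for m >= 0 only. *)
Definition s' (v : nat) (hv : (0 < v)%N) (N : arrows 'I_v) (m : int) : int :=
  - s hv N (m - v%:Z)
  + \sum_(i < v | (0 < i)%N) (N i (Ordinal hv))%:Z * s hv N (m - v%:Z + i%:Z).

Lemma s_neg (v : nat) (hv : (0 < v)%N) (N : arrows 'I_v) (m : int) :
  m < 0 -> s hv N m = 0.
Proof. by rewrite /s; case: `|m|%N => [|k] /= ->. Qed.

Lemma s_0 (v : nat) (hv : (0 < v)%N) (N : arrows 'I_v) : s hv N 0 = 1.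
Proof. by []. Qed.

Lemma s_fuel_stable (v : nat) (hv : (0 < v)%N) (N : arrows 'I_v) (k l : nat)
    (m : int) :
  m <= k%:Z -> m <= l%:Z -> s_fuel hv N k m = s_fuel hv N l m.
Proof.
elim: k l m => [|k IHk] [|l] m mk ml //=; case: ltrP => // m0; case: eqP => //.
- by move=> mN0; exfalso; lia.
- by move=> mN0; exfalso; lia.
move=> _; congr (- _ + _); first by apply: IHk; lia.
by apply: eq_bigr => i _; congr (_ * _); have iv := ltn_ord i; apply: IHk; lia.
Qed.

Lemma s_rec (v : nat) (hv : (0 < v)%N) (N : arrows 'I_v) (m : int) : 1 <= m ->
  s hv N m = - s hv N (m - v%:Z)
    + \sum_(i < v | (0 < i)%N) (N (Ordinal hv) i)%:Z * s hv N (m - v%:Z + i%:Z).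
Proof.
case: m => [[|k]|] // _; rewrite {1}/s /=.
congr (- _ + _); first by apply: s_fuel_stable; lia.
apply: eq_bigr => i _; congr (_ * _); have := ltn_ord i.
by move=> iv; apply: s_fuel_stable; lia.
Qed.

(** * The right-hand side *)

Definition in_W (n : nat) (w : seq nat) : bool :=
  sorted leq w && all (fun x => (1 <= x <= n)%N) w.

Definition phi (w : seq nat) : rat :=
  (size (permutations w))%:R / ((size w)`!)%:R.

Definition coef_term (v : nat) (hv : (0 < v)%N) (N : arrows 'I_v) (n : nat)
    (w : seq nat) : rat :=
  phi w *
  (\prod_(0 <= i < size w)
     (s hv N (n%:Z - (nth 0%N w i)%:Z)
      + \sum_(i.+1 <= j < size w)
          (- s hv N ((nth 0%N w j)%:Z - (nth 0%N w i)%:Z)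
           + s' hv N ((nth 0%N w j)%:Z - (nth 0%N w i)%:Z))))%:~R.

(* The exponent of y_{i+1}. *)
Definition expo_term (v : nat) (hv : (0 < v)%N) (N : arrows 'I_v)
    (w : seq nat) (i : 'I_v) : int :=
  \sum_(x <- w) s hv N (x%:Z - (i.+1)%:Z).

(** * Formal power series *)

(* A power series in y_1, ..., y_v, given by its coefficients. *)
Definition series (v : nat) := 'X_{1..v} -> rat.

(* S is the coefficientwise sum of the monomial terms                         *)
(* c w * prod_i y_i ^ (e w i) for w in W: all exponents are natural numbers,  *)
(* and each monomial occurs in finitely many terms.                           *)
Definition is_series_sum (v : nat) (I : eqType) (W : pred I) (c : I -> rat)
    (e : I -> 'I_v -> int) (S : series v) : Prop :=
  (forall w, W w -> forall i, 0 <= e w i) /\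
  (forall m : 'X_{1..v}, exists ws : seq I,
     [/\ uniq ws,
         forall w, (w \in ws) = W w && [forall i, e w i == (m i)%:Z] &
         S m = \sum_(w <- ws) c w]).

(* S is the expansion at y = 0 of the rational function f: writing f = P / D  *)
(* with D invertible as a power series, D * S = P.  The sum is the Cauchy     *)
(* product, in the form of [mcoeffM].                                         *)
Definition expands_to (v : nat) (f : ratfun v) (S : series v) : Prop :=
  exists P D : {mpoly rat[v]},
    [/\ D@_0%MM != 0,
        f = tofrac P / tofrac D &
        forall m : 'X_{1..v},
          \sum_(k : 'X_{1..v < (mdeg m).+1, (mdeg m).+1}
                | m == (k.1 + k.2)%MM) D@_(k.1) * S k.2 = P@_m].


Lemma expands_to_poly (v : nat) (p : {mpoly rat[v]}) (S : series v) :
  expands_to (tofrac p) S <-> forall m, S m = p@_m.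
Proof.
split=> [[P [D [D0 eqf DS]]] | Sp]; last first.
  exists p, 1; split; first by rewrite mcoeff1 eqxx oner_neq0.
    by rewrite tofrac1 divr1.
  move=> m; rewrite -[in RHS](mul1r p) mcoeffM.
  by apply: eq_bigr => k _; rewrite Sp.
have DN0 : D != 0 by apply: contraNneq D0 => ->; rewrite mcoeff0.
have PE : P = D * p.
  apply/eqP; rewrite -tofrac_eq tofracM eqf mulrC divfK //.
  by rewrite tofrac_eq0.
move=> m; have [d] := ubnP (mdeg m); elim: d m => // d IHd m /ltnSE md.
have := DS m; rewrite PE mcoeffM => /eqP; rewrite -subr_eq0 -sumrB.
have m0P : (mdeg (0%MM : 'X_{1..v}) < (mdeg m).+1)%N by rewrite mdeg0.
pose k0 := (BMultinom m0P, BMultinom (ltnSn (mdeg m))).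
rewrite (bigD1 k0) /=; last by rewrite add0m.
rewrite big1 ?addr0; last first.
  move=> [k1 k2] /= /andP[/eqP mE k12]; rewrite IHd ?subrr //.
  rewrite (leq_trans _ md) // [in ltnRHS]mE mdegD -[ltnLHS]add0n ltn_add2r.
  rewrite lt0n mdeg_eq0; apply: contraNneq k12 => k1E; apply/eqP.
  by congr pair; apply: val_inj => //=; rewrite [RHS]mE k1E add0m.
by rewrite -mulrBr mulf_eq0 (negPf D0) subr_eq0 => /eqP.
Qed.

(* Main.v *)
Require Import Defs.
From HB Require Import structures.
From mathcomp Require Import all_boot all_order all_algebra.
From mathcomp Require Import fraction ring_quotient generic_quotient zify ring.
From mathcomp.multinomials Require Import mpoly.

Set Implicit Arguments.
Unset Strict Implicit.
Unset Printing Implicit Defensive.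

Import Order.TTheory GRing.Theory Num.Theory.

Local Open Scope ring_scope.

(** Write F_m for the label created by the m-th mutation, with F_m = 1 for
    m <= 0.  The exchange relation at the n-th mutation is
    F_n F_(n-v) = prod_i F_(n-v+i-1)^N(1->i)
                  + y^(c_n) prod_i F_(n-v+i-1)^N(i->1),
    because rotation symmetry makes the base quiver look the same, up to
    relabelling, before every mutation ([quiver_at_base]), and greenness puts
    all frozen arrows on one side.  The vector c_n of frozen arrows obeys the
    recursion of s, so its i-th entry is s_(n-i) ([frozen_arrows]).

    Factoring out the first product and taking logarithms turns this into a
    linear recursion with the coefficients of s, driven by log (1 + Y_n), where
    Y_n is the second term on the right divided by the first.  Its solution is
    F_n = prod_(m <= n) (1 + Y_m)^s_(n-m),
    and substituting it into the definition of Y_m gives the triangular system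
    Y_m = y^(c_m) prod_(l < m) (1 + Y_l)^(s'_(m-l) - s_(m-l)).
    The proof goes backwards: the triangular system defines the Y_m, and the
    product of their powers satisfies the exchange relation
    ([label_expansion_exchange]), hence is the expansion of the label
    ([mut_label_expansion]).

    The sum over words appears when that product is expanded by the binomial
    series, starting from the largest index n: choosing the k-th term
    binomial(a_n, k) Y_n^k contributes k letters n to the word, the monomial
    y^(k c_n), and adds k (s'_(n-l) - s_(n-l)) to the exponent of each remaining
    factor 1 + Y_l ([prod_pow1p_expand]).  The product of these shifted
    binomials is the coefficient of the word.

    Power series identities are checked modulo monomials of degree > d, for
    each d.  In such a quotient every Y_m is nilpotent, so the binomial series
    is a finite sum and makes sense for negative exponents. *)

(** * Integer powers of 1 + u for nilpotent u *)

(** Binomial coefficient with an arbitrary integer on top. *)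
Definition gbin (a : int) (k : nat) : rat :=
  (\prod_(0 <= i < k) (a - i%:Z))%:~R / (k`!)%:R.

Lemma gbin0 a : gbin a 0 = 1.
Proof. by rewrite /gbin big_geq // divr1. Qed.

Lemma gbin_pascal a k : gbin (a + 1) k.+1 = gbin a k.+1 + gbin a k.
Proof.
have kN0 : (k`!)%:R != 0 :> rat by rewrite pnatr_eq0 -lt0n fact_gt0.
have SkN0 : k.+1%:R != 0 :> rat by rewrite pnatr_eq0.
rewrite /gbin big_nat_recl // big_nat_recr //= factS subr0.
rewrite (eq_bigr (fun i : nat => a - i%:Z)); last by move=> i _; lia.
set p := \prod_(_ <= _ < _) _; rewrite !intrM natrM !intrD mulrNz.
by move: SkN0; rewrite -natr1 => ?; field; apply/andP.
Qed.

Lemma gbin_0S k : gbin 0 k.+1 = 0.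
Proof. by rewrite /gbin big_nat_recl // subr0 mul0r mul0r. Qed.

Section IntegerPowers.

Variables (A : comNzRingType) (h : {rmorphism rat -> A}) (d : nat).

(** The binomial series of (1 + u)^a, cut where the powers of a nilpotent u
    vanish.  The coefficients come from rat through [h], which lets a quotient
    of a polynomial ring be used without building its algebra structure. *)
Definition pow1p (u : A) (a : int) : A :=
  \sum_(0 <= k < d.+1) h (gbin a k) * u ^+ k.

Variable u : A.
Hypothesis u_nil : u ^+ d.+1 = 0.

Lemma pow1p_0 : pow1p u 0 = 1.
Proof.
rewrite /pow1p big_nat_recl // gbin0 rmorph1 mulr1 big1 ?addr0 // => k _.
by rewrite gbin_0S rmorph0 mul0r.
Qed.

Lemma pow1p_S a : pow1p u (a + 1) = (1 + u) * pow1p u a.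
Proof.
rewrite mulrDl mul1r {3}/pow1p big_distrr /= big_nat_recr //=.
rewrite mulrCA -exprS u_nil mulr0 addr0 /pow1p !big_nat_recl // !gbin0 -addrA.
congr (_ + _); rewrite -big_split; apply: eq_bigr => k _ /=.
by rewrite gbin_pascal rmorphD mulrDl [u * _]mulrCA exprS.
Qed.

Lemma pow1p_1 : pow1p u 1 = 1 + u.
Proof. by have := pow1p_S 0; rewrite add0r pow1p_0 mulr1. Qed.

(** The step from a to a + 1 is Pascal's rule; since 1 + u is invertible, with
    inverse [pow1p u (-1)], the induction also runs downwards. *)
Lemma pow1p_D a b : pow1p u (a + b) = pow1p u a * pow1p u b.
Proof.
have inv : pow1p u (-1) * (1 + u) = 1 by rewrite mulrC -pow1p_S addNr pow1p_0.
elim/int_ind: a => [|n IH|n IH]; first by rewrite add0r pow1p_0 mul1r.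
  by rewrite intS [1 + _]addrC addrAC !pow1p_S IH mulrA.
rewrite -[LHS]mul1r -inv -mulrA -pow1p_S.
have -> : - n.+1%:Z + b + 1 = - n%:Z + b by lia.
have E : - n%:Z = - n.+1%:Z + 1 by lia.
by rewrite IH E pow1p_S !mulrA inv mul1r.
Qed.

Lemma pow1p_sum (I : Type) (r : seq I) (P : pred I) (c : I -> int) :
  pow1p u (\sum_(i <- r | P i) c i) = \prod_(i <- r | P i) pow1p u (c i).
Proof. exact: (big_morph (pow1p u) pow1p_D pow1p_0). Qed.

Lemma pow1p_M (k : nat) a : pow1p u (k%:Z * a) = pow1p u a ^+ k.
Proof.
elim: k => [|k IH]; first by rewrite mul0r pow1p_0 expr0.
by rewrite intS mulrDl mul1r pow1p_D IH exprS.
Qed.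

End IntegerPowers.

(** * Words and their coefficients *)

(** The multinomial count of rearrangements, by induction on the length:
    removing a first letter x leaves (size s - 1)! / prod rearrangements times
    the multiplicity of x, and the multiplicities add up to size s.  The index
    list [U] may exceed the letters of [s], so that two words can share it. *)
Lemma size_permutations_count (T : eqType) (U s : seq T) :
    uniq U -> {subset s <= U} ->
  (size (permutations s) * \prod_(x <- U) (count_mem x s)`! = (size s)`!)%N.
Proof.
move=> Uu; have [m] := ubnP (size s); elim: m s => // m IH s sm sU.
have [->|sN0] := eqVneq s [::].
  by rewrite /= big1 //.
rewrite (perm_size (permutationsE _)) ?lt0n ?size_eq0 //.
rewrite size_allpairs_dep sumnE big_map big_distrl /=.
have E x : x \in s -> (size (permutations (rem x s))
      * \prod_(y <- U) (count_mem y s)`! = count_mem x s * (size s).-1`!)%N.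
  move=> xs; rewrite -(size_rem xs) -(IH (rem x s)).
  - rewrite mulnCA; congr muln; rewrite !(bigD1_seq x) ?sU //= mulnA.
    have cx : (0 < count_mem x s)%N by rewrite -has_count has_pred1.
    rewrite count_mem_rem eqxx -[in LHS](prednK cx) factS prednK // subn1.
    congr muln; apply: eq_bigr => y yx.
    by rewrite count_mem_rem eq_sym (negPf yx) subn0.
  - by rewrite size_rem //; case: (s) sm sN0.
  - by move=> y /mem_rem /sU.
rewrite (eq_big_seq (fun x => count_mem x s * (size s).-1`!)%N); last first.
  by move=> x; rewrite mem_undup => /E.
rewrite -big_distrl /=.
have -> : (\sum_(x <- undup s) count_mem x s)%N = size s.
  rewrite -sum1_size -[RHS]big_undup_iterop_count.
  by apply: eq_bigr => x _; rewrite Monoid.iteropE iter_addn_0 mul1n.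
by case: (s) sN0 => //= x s' _; rewrite factS.
Qed.

(** phi is 1 over the product of the factorials of the multiplicities, hence
    multiplicative when a block of a new letter is appended. *)
Lemma phi_cat_nseq (w : seq nat) k n : n \notin w ->
  phi (w ++ nseq k n) = phi w / (k`!)%:R.
Proof.
move=> nw.
have fN0 m : (m`!)%:R != 0 :> rat by rewrite pnatr_eq0 -lt0n fact_gt0.
pose U := n :: undup w.
have Uu : uniq U by rewrite /= mem_undup nw undup_uniq.
have wU : {subset w <= U} by move=> x xw; rewrite inE mem_undup xw orbT.
have wkU : {subset w ++ nseq k n <= U}.
  by move=> x; rewrite mem_cat => /orP[/wU//|/nseqP[-> _]]; rewrite inE eqxx.
have := size_permutations_count Uu wU; have := size_permutations_count Uu wkU.
rewrite !big_cons count_cat count_nseq /= eqxx mul1n (count_memPn nw) mul1n.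
rewrite (eq_big_seq (fun x => (count_mem x w)`!)%N); last first.
  move=> x; rewrite mem_undup => xw; rewrite count_cat count_nseq /=.
  by have /negPf-> : n != x by [apply: contraNneq nw => ->]; rewrite addn0.
set p := \prod_(_ <- _) _ => E1 E2.
have pN0 : p%:R != 0 :> rat.
  rewrite pnatr_eq0; apply: contraTneq (fact_gt0 (size w)) => p0.
  by rewrite -E2 p0 muln0.
rewrite /phi -E1 -E2 !natrM.
have := fN0 (size (w ++ nseq k n)); have := fN0 (size w).
rewrite -E1 -E2 !natrM !mulf_eq0 !negb_or => /andP[n1 _] /andP[n2 _].
by field; rewrite n1 n2 fN0 pN0.
Qed.

(** [coef_term] with arbitrary exponents [a x] in place of s_(n-x) and
    arbitrary interactions [b y x] in place of s'_(y-x) - s_(y-x): the exponents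
    have to vary for the recursion on the largest letter. *)
Definition word_coef (a : nat -> int) (b : nat -> nat -> int) (w : seq nat) :
    rat :=
  phi w *
  (\prod_(0 <= i < size w)
     (a (nth 0%N w i)
      + \sum_(i.+1 <= j < size w) b (nth 0%N w j) (nth 0%N w i)))%:~R.

(** Each of the k letters n shifts the factor of a smaller letter x by
    [b n x].  Inside the block, [b n n = -1] makes the k factors
    a_n, a_n - 1, ..., a_n - k + 1, which with the 1/k! of phi form a binomial
    coefficient. *)
Lemma word_coef_cat_nseq a b (w : seq nat) k n : n \notin w -> b n n = -1 ->
  word_coef a b (w ++ nseq k n) =
  gbin (a n) k * word_coef (fun x => a x + k%:Z * b n x) b w.
Proof.
move=> nw bnn; rewrite /word_coef phi_cat_nseq // size_cat size_nseq.
rewrite (big_cat_nat (n := size w)) ?leq_addr //=.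
rewrite [X in (X * _)%:~R](eq_big_nat _ _ (F2 := fun i =>
    a (nth 0%N w i) + k%:Z * b n (nth 0%N w i)
    + \sum_(i.+1 <= j < size w) b (nth 0%N w j) (nth 0%N w i))); last first.
  move=> i /= iw; rewrite nth_cat iw (big_cat_nat (n := size w)) ?leq_addr //=.
  rewrite -addrA [k%:Z * _ + _]addrC; congr (_ + (_ + _)).
    by apply: eq_big_nat => j /andP[_ jw]; rewrite nth_cat jw.
  rewrite (eq_big_nat _ _ (F2 := fun=> b n (nth 0%N w i))); last first.
    move=> j /andP[jw jk]; rewrite nth_cat ltnNge jw /= nth_nseq.
    by rewrite -(ltn_add2l (size w)) subnKC // jk.
  by rewrite big_const_nat iter_addr_0 addKn -mulr_natl natz.
have -> : \prod_(size w <= i < size w + k) (a (nth 0%N (w ++ nseq k n) i)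
      + \sum_(i.+1 <= j < size w + k)
          b (nth 0%N (w ++ nseq k n) j) (nth 0%N (w ++ nseq k n) i))
    = \prod_(0 <= i < k) (a n - i%:Z).
  rewrite -{1}[size w]add0n big_addn addKn [RHS]big_nat_rev /= add0n.
  have nthn j : (size w <= j < size w + k)%N -> nth 0%N (w ++ nseq k n) j = n.
    move=> /andP[jw jk]; rewrite nth_cat ltnNge jw /= nth_nseq.
    by rewrite -(ltn_add2l (size w)) subnKC // jk.
  apply: eq_big_nat => i /= ik; rewrite nthn; last by lia.
  congr (_ + _); rewrite (eq_big_nat _ _ (F2 := fun=> -1)); last first.
    by move=> j /andP[jw jk]; rewrite nthn ?bnn //; lia.
  by rewrite big_const_nat iter_addr_0 -mulr_natl; lia.
rewrite intrM /gbin; ring.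
Qed.

(** The sorted words in the letters 1, ..., n with multiplicities at most d,
    built by appending the block of the largest letter last. *)
Fixpoint words (d n : nat) : seq (seq nat) :=
  if n is n'.+1
  then [seq w ++ nseq k n | w <- words d n', k <- iota 0 d.+1]
  else [:: [::]].

Lemma wordsS d n :
  words d n.+1 = [seq w ++ nseq k n.+1 | w <- words d n, k <- iota 0 d.+1].
Proof. by []. Qed.

Lemma sorted_nseq k n : sorted leq (nseq k n).
Proof.
rewrite (sorted_pairwise leq_trans); elim: k => //= k ->; rewrite andbT.
by apply/allP => x /nseqP[-> _].
Qed.

Lemma words_in_W d n w : w \in words d n -> in_W n w.
Proof.
elim: n w => [|n IH] w; first by rewrite inE => /eqP->.
rewrite wordsS => /allpairsP[[w' k] /= [/IH/andP[ws /allP wn] _ ->]].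
rewrite /in_W !(sorted_pairwise leq_trans) pairwise_cat in ws *.
apply/andP; split.
  rewrite ws /=; apply/andP; split.
    by apply/allrelP => x y /wn xn /nseqP[-> _]; lia.
  by rewrite -(sorted_pairwise leq_trans) sorted_nseq.
rewrite all_cat all_nseq /= leqnn orbT andbT.
by apply/allP => x /wn; lia.
Qed.

Lemma in_W_words d n w : in_W n w -> (size w <= d)%N -> w \in words d n.
Proof.
elim: n w => [|n IH] w /andP[ws wn] wd.
  by case: w ws wn wd => // x w _ /= /andP[]; lia.
have Ew : w = [seq x <- w | (x <= n)%N] ++ nseq (count_mem n.+1 w) n.+1.
  apply: (sorted_eq leq_trans anti_leq) => //.
    rewrite (sorted_pairwise leq_trans) pairwise_cat.
    rewrite -!(sorted_pairwise leq_trans).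
    rewrite (sorted_filter leq_trans) //=; apply/andP; split.
      apply/allrelP => x y; rewrite mem_filter => /andP[xn _] /nseqP[-> _].
      by lia.
    exact: sorted_nseq.
  rewrite -(perm_filterC (fun x => x <= n)%N w) perm_sym perm_cat2l.
  have -> : nseq (count_mem n.+1 w) n.+1
      = [seq x <- w | predC (fun x => (x <= n)%N) x]; last by [].
  rewrite -size_filter (@eq_in_filter _ _ (pred1 n.+1) w); last first.
    by move=> x /(allP wn) /=; lia.
  by apply/esym/all_pred1P; rewrite filter_all.
rewrite Ew wordsS; apply: (allpairs_f (fun w k => w ++ nseq k n.+1)).
  apply: IH; last by rewrite size_filter (leq_trans (count_size _ _)).
  rewrite /in_W (sorted_filter leq_trans) //=; apply/allP => x.
  by rewrite mem_filter => /andP[xn /(allP wn)]; lia.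
by rewrite mem_iota /= add0n ltnS (leq_trans (count_size _ _)).
Qed.

Lemma words_notin d n w : w \in words d n -> n.+1 \notin w.
Proof. by move=> /words_in_W /andP[_ /allP wn]; apply/negP => /wn; lia. Qed.

Lemma words_uniq d n : uniq (words d n).
Proof.
elim: n => // n IH; rewrite wordsS; apply: allpairs_uniq; rewrite ?iota_uniq //.
move=> _ _ /allpairsP[[w k] [wn _ ->]] /allpairsP[[w' k'] [wn' _ ->]].
rewrite /= in wn wn' * => E.
have Ek : k = k'.
  have := congr1 (count_mem n.+1) E; rewrite !count_cat !count_nseq.
  rewrite /= eqxx !mul1n.
  by rewrite (count_memPn (words_notin wn)) (count_memPn (words_notin wn')).
move: E; rewrite Ek => E; congr pair.
have /eqP := E; rewrite eqseq_cat; first by case/andP => /eqP.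
by have := congr1 size E; rewrite !size_cat => /addIn.
Qed.

(** * Expansion of a triangular system over words *)

Section Expansion.

Variables (A : comNzRingType) (h : {rmorphism rat -> A}) (d : nat).
Variables (z Y : nat -> A) (b : nat -> nat -> int).

Hypothesis Y_nil : forall m, (0 < m)%N -> Y m ^+ d.+1 = 0.
Hypothesis Y_rec : forall m,
  Y m = z m * \prod_(1 <= l < m) pow1p h d (Y l) (b m l).
Hypothesis b_diag : forall m, b m m = -1.

(** Expanding the last factor in powers of Y_(n+1), and each Y_(n+1) by its
    defining product, leaves a product of the same shape over 1, ..., n with
    shifted exponents, to which induction applies. *)
Lemma prod_pow1p_expand n (a : nat -> int) :
  \prod_(1 <= l < n.+1) pow1p h d (Y l) (a l)
    = \sum_(w <- words d n) h (word_coef a b w) * \prod_(x <- w) z x.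
Proof.
elim: n a => [|n IH] a.
  by rewrite big_geq // big_seq1 big_nil /word_coef big_geq //= mulr1 rmorph1.
rewrite wordsS big_nat_recr // big_allpairs_dep exchange_big /=.
rewrite {2}/pow1p /index_iota subn0 big_distrr /=; apply: eq_bigr => k _.
rewrite [in LHS]Y_rec exprMn -prodrXl.
transitivity (h (gbin (a n.+1) k) * (z n.+1 ^+ k *
   \prod_(1 <= l < n.+1) pow1p h d (Y l) (a l + k%:Z * b n.+1 l))).
  rewrite [in RHS](eq_big_nat _ _ (F2 := fun l => pow1p h d (Y l) (a l)
                              * pow1p h d (Y l) (b n.+1 l) ^+ k)).
    by rewrite big_split /=; ring.
  by move=> l /andP[l0 _]; rewrite pow1p_D ?pow1p_M ?Y_nil.
rewrite IH !big_distrr /=; apply: eq_big_seq => w /words_notin nw.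
rewrite word_coef_cat_nseq // [in RHS]rmorphM big_cat /= big_nseq iter_mulr_1.
ring.
Qed.

End Expansion.

(** * Mutations of the framed quiver *)

Section MutationDynamics.

Variables (v : nat) (hv : (0 < v)%N) (N : arrows 'I_v).
Hypothesis hN : symmetric_quiver hv N.

Local Notation mv := (mutvertex hv).
Local Notation sz := (s hv N).

Lemma mutvertex0 : mv 0 = Ordinal hv.
Proof. by apply: val_inj; rewrite /= mod0n. Qed.

Lemma mutvertex_ord (i : 'I_v) : mv i = i.
Proof. by apply: val_inj; rewrite /= modn_small. Qed.

Lemma mutvertexDv t : mv (t + v) = mv t.
Proof. by apply: val_inj; rewrite /= modnDr. Qed.

Lemma mutvertex_addl_inj t : injective (fun j : 'I_v => mv (t + j)).
Proof.
move=> i j /(congr1 val) /= /eqP; rewrite eqn_modDl => /eqP E.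
apply: val_inj => /=.
by rewrite -(modn_small (ltn_ord i)) -(modn_small (ltn_ord j)).
Qed.

Lemma mutvertex_addl_neq t j : (0 < j < v)%N -> mv (t + j) != mv t.
Proof.
move=> /andP[j0 jv]; apply/eqP => /(congr1 val) /= /eqP.
by rewrite -{2}[t]addn0 eqn_modDl mod0n modn_small // => /eqP; lia.
Qed.

Lemma ord_pred_mutvertex t : ord_pred (mv t.+1) = mv t.
Proof.
apply: val_inj; rewrite /= -subn1 -addnBA // modnDml.
by rewrite (_ : t.+1 + (v - 1) = t + v)%N ?modnDr //; lia.
Qed.

Lemma iter_ord_pred_mutvertex t j : iter t (@ord_pred v) (mv (t + j)) = mv j.
Proof. by elim: t => // t IH; rewrite iterSr addSn ord_pred_mutvertex. Qed.

(** One mutation at the current vertex is the rotation [ord_pred], by the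
    second symmetry; mutating the base quiver ignores the frozen vertices. *)
Lemma quiver_at_base_iter t x y :
  quiver_at hv N t (inl x) (inl y)
    = N (iter t (@ord_pred v) x) (iter t (@ord_pred v) y).
Proof.
elim: t x y => // t IH x y /=; rewrite (sq_rotate hN).
have inj : injective (iter t (@ord_pred v)).
  by elim: (t) => // u IHu; apply: inj_comp IHu; apply: ord_pred_inj.
have E0 : iter t (@ord_pred v) (mv t) = Ordinal hv.
  by rewrite -[t in mv t]addn0 iter_ord_pred_mutvertex mutvertex0.
have Ek w : (iter t (@ord_pred v) w == Ordinal hv) = (w == mv t).
  by rewrite -E0 inj_eq.
by rewrite /mutate /cancel2 /mutate_arrows !(inj_eq inl_inj) !Ek !IH E0.
Qed.

Lemma quiver_at_base t i j :
  quiver_at hv N t (inl (mv (t + i))) (inl (mv (t + j))) = N (mv i) (mv j).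
Proof. by rewrite quiver_at_base_iter !iter_ord_pred_mutvertex. Qed.

(** The i-th entry of the c-vector of x, in the sense of cluster algebras. *)
Definition cvec t (i x : 'I_v) : int :=
  (quiver_at hv N t (inr i) (inl x))%:Z - (quiver_at hv N t (inl x) (inr i))%:Z.

Lemma cvec_green t i :
  cvec t i (mv t) = (quiver_at hv N t (inr i) (inl (mv t)))%:Z.
Proof. by rewrite /cvec (sq_green hN) subr0. Qed.

Lemma cvecS_mut t i : cvec t.+1 i (mv t) = - cvec t i (mv t).
Proof.
rewrite /cvec /= /mutate /cancel2 /mutate_arrows eqxx /=.
by lia.
Qed.

Lemma cvecS t i x : x != mv t ->
  cvec t.+1 i x
    = cvec t i x + cvec t i (mv t) * (quiver_at hv N t (inl (mv t)) (inl x))%:Z.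
Proof.
move=> xN; rewrite cvec_green /cvec /= /mutate /cancel2 /mutate_arrows.
rewrite (inj_eq inl_inj) (negPf xN) /= (sq_green hN) muln0 addn0; lia.
Qed.

Definition arrows_out j : int := (N (Ordinal hv) (mv j))%:Z.

Lemma out_sym j : (0 < j < v)%N -> arrows_out (v - j) = arrows_out j.
Proof.
move=> jv; have [|E _] := @sq_first _ _ _ hN (mv (v - j)) (mv j).
  by rewrite /= !modn_small; lia.
by rewrite /arrows_out E.
Qed.

Lemma sum_vertex (F : nat -> int) :
  \sum_(i < v | (0 < i)%N) F i = \sum_(1 <= i < v) F i.
Proof.
rewrite -(big_mkord (fun i => 0 < i)%N F) big_ltn_cond //= big_nat_cond.
by rewrite [RHS]big_nat_cond; apply: eq_bigl => i; lia.
Qed.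

Lemma s_rec_out m : 1 <= m ->
  sz m = - sz (m - v%:Z)
         + \sum_(1 <= i < v) arrows_out i * sz (m - v%:Z + i%:Z).
Proof.
move=> m1; rewrite s_rec //.
rewrite -(sum_vertex (fun i => arrows_out i * sz (m - v%:Z + i%:Z))).
by congr (_ + _); apply: eq_bigr => i _; rewrite /arrows_out mutvertex_ord.
Qed.

(** The vertex [mv (t + j)] is next mutated at time t + j, when its c-vector has
    to be s_(t+j-i); until then it gains from each of the j vertices mutated in
    between, and the closed form subtracts these gains.  It is stable under one
    mutation: for j = v - 1, the vertex mutated last, this is the recursion of
    s read with the third symmetry. *)
Lemma cvec_closed t i j : (j < v)%N ->
  cvec t i (mv (t + j))
    = sz ((t + j)%:Z - i%:Z)
      - \sum_(0 <= u < j) arrows_out (j - u) * sz ((t + u)%:Z - i%:Z).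
Proof.
elim: t j => [|t IH] j jv.
  rewrite /cvec /= add0n subr0; have iv := ltn_ord i.
  have -> : (i == mv j) = (j == i :> nat).
    by rewrite -val_eqE /= modn_small // eq_sym.
  case: (ltngtP j i) => ji.
  - rewrite s_neg ?big_nat ?big1 ?subr0 //; last by lia.
    by move=> u /= uj; rewrite s_neg ?mulr0 //; lia.
  (* Only indices between 0 and j - i survive in both sums, which then agree
     under the substitution u |-> v - (j - u) of the third symmetry. *)
  - rewrite s_rec_out; last by lia.
    rewrite s_neg ?oppr0 ?add0r; last by lia.
    rewrite [X in _ - X](@big_cat_nat _ _ _ i) //=; last by lia.
    rewrite [X in _ - (X + _)]big_nat [X in _ - (X + _)]big1 ?add0r; last first.
      by move=> u /= ui; rewrite s_neg ?mulr0 //; lia.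
    rewrite (@big_cat_nat _ _ _ (i + (v - j))%N) //=; [|by lia..].
    rewrite [X in X + _ + _]big_nat [X in X + _ + _]big1 ?add0r; last first.
      by move=> u /= ui; rewrite s_neg ?mulr0 //; lia.
    rewrite [X in X + _]big_addn subKn; last by lia.
    apply/esym/eqP; rewrite subr_eq0; apply/eqP/esym.
    apply: eq_big_nat => u /= ui; rewrite -(out_sym (j := j - u)); last by lia.
    by congr (arrows_out _ * sz _); lia.
  - rewrite ji subrr s_0 big_nat big1 ?subr0 //.
    by move=> u /= ui; rewrite s_neg ?mulr0 //; lia.
have vt : cvec t i (mv t) = sz (t%:Z - i%:Z).
  by rewrite -{2}[t]addn0 IH // big_geq // subr0 addn0.
case: (ltngtP j.+1 v) => jv1; last 1 first.
(* The vertex mutated at time t, whose c-vector has just changed sign. *)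
- rewrite addSn -addnS jv1 mutvertexDv cvecS_mut vt.
  rewrite (@s_rec_out ((t + v)%:Z - i%:Z)); last first.
    by have := ltn_ord i; lia.
  have -> : (t + v)%:Z - i%:Z - v%:Z = t%:Z - i%:Z by lia.
  rewrite -addrA -[LHS]addr0; congr (_ + _); apply/esym/eqP.
  rewrite subr_eq0 big_add1 (_ : v.-1 = j); last by lia.
  apply/eqP/eq_big_nat => u uj; rewrite -[arrows_out u.+1]out_sym; last by lia.
  by rewrite (_ : v - u.+1 = j - u)%N; [congr (_ * sz _) | ]; lia.
- rewrite addSn -addnS cvecS ?mutvertex_addl_neq //.
  rewrite -[X in quiver_at _ _ _ (inl (mv X))]addn0 quiver_at_base mutvertex0.
  rewrite vt IH // big_nat_recl // addn0 subn0 -/(arrows_out j.+1).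
  rewrite (eq_big_nat _ _ (F2 := fun u =>
    arrows_out (j - u) * sz ((t.+1 + u)%:Z - i%:Z))).
    by ring.
  by move=> u uj; rewrite subSS addSnnS.
- by move: jv jv1; lia.
Qed.

Lemma frozen_arrows t i :
  (quiver_at hv N t (inr i) (inl (mv t)))%:Z = sz (t%:Z - i%:Z).
Proof.
by rewrite -cvec_green -{2}[t]addn0 cvec_closed // big_geq // subr0 addn0.
Qed.

Lemma s_ge0 m : 0 <= sz m.
Proof.
case: m => [t|t]; last by rewrite s_neg.
by have := frozen_arrows t (Ordinal hv); rewrite subr0 => <-.
Qed.

(** The c-vectors are nonzero: if s vanished on v consecutive indices, its
    recursion, in which the term s_(m-v) has coefficient -1, would propagate the
    zeros down to s_0 = 1. *)
Lemma s_window_neq0 t : exists i : 'I_v, 0 < sz (t%:Z - i%:Z).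
Proof.
apply/existsP; elim: t => [|t].
  by apply/existsP; exists (Ordinal hv); rewrite subr0 s_0.
apply: contraTT; rewrite !negb_exists => /forallP s0; apply/forallP => i.
have z0 k : (k < v)%N -> sz (t.+1%:Z - k%:Z) = 0.
  by move=> kv; have := s0 (Ordinal kv); rewrite lt0r s_ge0 andbT negbK => /eqP.
rewrite -leNgt; have iv := ltn_ord i.
have [iv1|iv1] := ltnP i.+1 v.
  by rewrite (_ : t%:Z - i%:Z = t.+1%:Z - i.+1%:Z) ?z0 //; lia.
have := @s_rec_out t.+1 isT; have := z0 0%N hv; rewrite subr0 => ->.
rewrite big_nat big1 ?addr0 => [|k /= kv]; last first.
  by rewrite (_ : _ + _ = t.+1%:Z - (v - k)%:Z) ?z0 ?mulr0 //; lia.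
move/eqP; rewrite eq_sym oppr_eq0 => /eqP E.
by rewrite (_ : _ - _ = t.+1%:Z - v%:Z) ?E //; lia.
Qed.

Lemma sum_drop_first (F : 'I_v -> int) : F (Ordinal hv) = 0 ->
  \sum_(i < v | (0 < i)%N) F i = \sum_(i < v) F i.
Proof.
move=> F0; rewrite [RHS](bigD1 (Ordinal hv)) //= F0 add0r.
by apply: eq_bigl => i; rewrite lt0n.
Qed.

Lemma sum_out m : 1 <= m ->
  \sum_(i < v) (N (Ordinal hv) i)%:Z * sz (m - v%:Z + i%:Z)
    = sz m + sz (m - v%:Z).
Proof.
move=> m1; rewrite [sz m]s_rec // addrAC addNr add0r sum_drop_first //.
by rewrite (proj1 (sq_quiver hN)) mul0r.
Qed.

Lemma sum_in m :
  \sum_(i < v) (N i (Ordinal hv))%:Z * sz (m - v%:Z + i%:Z)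
    = s' hv N m + sz (m - v%:Z).
Proof.
rewrite /s' addrAC addNr add0r sum_drop_first //.
by rewrite (proj1 (sq_quiver hN)) mul0r.
Qed.

Lemma s'_0 : s' hv N 0 = 0.
Proof.
have iv (i : 'I_v) := ltn_ord i.
rewrite /s' s_neg ?big1 ?addr0 //; last by lia.
by move=> i _; rewrite s_neg ?mulr0 //; have := iv i; lia.
Qed.

(** The label written at step q - v + 1, and 1 for the initial labels; the shift
    by v keeps the index a natural number.  Just before the (t + 1)-st mutation
    the label at [mv (t + j)] is [mut_label (t + j)], for j < v. *)
Definition mut_label q : ratfun v :=
  if (q < v)%N then 1 else label_at hv N (q - v).+1 (inl (mv (q - v))).

Lemma Fpoly_mut_label n : (0 < n)%N -> Fpoly hv N n = mut_label (n.-1 + v).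
Proof.
by case: n => // n _; rewrite /Fpoly /mut_label ltnNge leq_addl /= addnK.
Qed.

Lemma label_at_mut_label t j : (j < v)%N ->
  label_at hv N t (inl (mv (t + j))) = mut_label (t + j).
Proof.
elim: t j => [|t IH] j jv; first by rewrite /mut_label add0n jv.
have [jv1|jv1] := ltnP j.+1 v.
  rewrite addSn -addnS /= /mutate_label (inj_eq inl_inj).
  by rewrite (negPf (mutvertex_addl_neq _ _)) ?IH.
have {jv1}jv : j.+1 = v by lia.
by rewrite addSn -addnS jv mutvertexDv /mut_label ltnNge leq_addl /= addnK.
Qed.

Lemma label_at_frozen t i :
  label_at hv N t (inr i) = tofrac ('X_i : {mpoly rat[v]}).
Proof. by elim: t. Qed.

Lemma mut_label_exchange t :
  mut_label (t + v) =
   ((\prod_(i < v) tofrac ('X_i : {mpoly rat[v]}) ^+ `|sz (t%:Z - i%:Z)|)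
      * \prod_(j < v) mut_label (t + j) ^+ N j (Ordinal hv)
    + \prod_(j < v) mut_label (t + j) ^+ N (Ordinal hv) j) / mut_label t.
Proof.
rewrite {1}/mut_label ltnNge leq_addl /= addnK /mutate_label eqxx.
have Lt : label_at hv N t (inl (mv t)) = mut_label t.
  by rewrite -[t in mv t]addn0 label_at_mut_label ?addn0.
have bij : \prod_(j < v) mut_label (t + j) ^+ N j (Ordinal hv)
    = \prod_(x : 'I_v)
        label_at hv N t (inl x) ^+ quiver_at hv N t (inl x) (inl (mv t)).
  rewrite [RHS](reindex_inj (@mutvertex_addl_inj t)); apply: eq_bigr => j _ /=.
  rewrite label_at_mut_label // -[X in _ (inl (mv X))]addn0.
  by rewrite quiver_at_base mutvertex0 mutvertex_ord.
have bij' : \prod_(j < v) mut_label (t + j) ^+ N (Ordinal hv) j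
    = \prod_(x : 'I_v)
        label_at hv N t (inl x) ^+ quiver_at hv N t (inl (mv t)) (inl x).
  rewrite [RHS](reindex_inj (@mutvertex_addl_inj t)); apply: eq_bigr => j _ /=.
  rewrite label_at_mut_label // -[X in quiver_at _ _ _ (inl (mv X)) _]addn0.
  by rewrite quiver_at_base mutvertex0 mutvertex_ord.
rewrite Lt bij bij' !big_sumType /=; congr ((_ + _) / _).
  rewrite mulrC; congr (_ * _); apply: eq_bigr => i _.
  by rewrite label_at_frozen -frozen_arrows.
rewrite [X in _ * X]big1 ?mulr1 // => i _; rewrite (sq_green hN) //.
Qed.

End MutationDynamics.

(** * Power series by truncation *)

Section Truncation.

Variable v : nat.
Implicit Types (p q : {mpoly rat[v]}) (m : 'X_{1..v}).

Lemma leq_mdeg_addr m m1 m2 : m = (m1 + m2)%MM -> (mdeg m2 <= mdeg m)%N.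
Proof. by move->; rewrite mdegD leq_addl. Qed.

Definition high_degree (d : nat) : pred {mpoly rat[v]} :=
  fun p => all (fun m => d < mdeg m)%N (msupp p).

Lemma high_degreeP d p :
  reflect (forall m, (mdeg m <= d)%N -> p@_m = 0) (p \in high_degree d).
Proof.
apply: (iffP allP) => [H m md|H m].
  by apply/eqP; rewrite mcoeff_eq0; apply/negP => /H; lia.
by rewrite mcoeff_msupp ltnNge => mN0; apply: contra mN0 => /H->.
Qed.

Lemma high_degree_idealr d : idealr_closed (high_degree d).
Proof.
split=> [||a p q /high_degreeP p0 /high_degreeP q0].
- by apply/high_degreeP => m _; rewrite mcoeff0.
- apply/high_degreeP => /(_ 0%MM); rewrite mdeg0 mcoeff1 eqxx => /(_ isT) /eqP.
  by rewrite oner_eq0.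
apply/high_degreeP => m md; rewrite mcoeffD q0 // addr0 mcoeffM big1 // => k.
move=> /eqP mE; rewrite (p0 k.2) ?mulr0 //.
exact: leq_trans (leq_mdeg_addr mE) md.
Qed.

HB.instance Definition _ d :=
  isIdealr.Build {mpoly rat[v]} (high_degree d) (high_degree_idealr d).

Definition high_ideal d : idealr {mpoly rat[v]} := high_degree d.

Definition truncated d := {ideal_quot (high_ideal d)}.

HB.instance Definition _ d := GRing.ComNzRing.on (truncated d).

Definition trunc d : {rmorphism {mpoly rat[v]} -> truncated d} :=
  \pi_(truncated d)%qT.

Lemma truncP d p q :
  (forall m, (mdeg m <= d)%N -> p@_m = q@_m) <-> trunc d p = trunc d q.
Proof.
rewrite /trunc /=; split=> [H|/eqP].
  apply/eqP; rewrite -Quotient.idealrBE; apply/high_degreeP => m md.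
  by rewrite mcoeffB H ?subrr.
rewrite -Quotient.idealrBE => /high_degreeP H m md.
by apply/eqP; rewrite -subr_eq0 -mcoeffB H.
Qed.

Definition trunc_const d : {rmorphism rat -> truncated d} :=
  trunc d \o (@mpolyC v rat).

Lemma truncZ d c p : trunc d (c *: p) = trunc_const d c * trunc d p.
Proof. by rewrite -mul_mpolyC rmorphM. Qed.

(** [g] is the family of truncations of the power series of [f].  As in
    [expands_to], this is tested by clearing a denominator. *)
Definition expansion (f : ratfun v) (g : forall d, truncated d) : Prop :=
  exists P D : {mpoly rat[v]},
    [/\ D@_0%MM != 0, f = tofrac P / tofrac D
      & forall d, trunc d D * g d = trunc d P].

Lemma tofrac_neq0 p : p@_0%MM != 0 -> tofrac p != 0 :> ratfun v.
Proof. by rewrite tofrac_eq0; apply: contraNneq => ->; rewrite mcoeff0. Qed.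

Lemma mcoeff0M p q : (p * q)@_0%MM = p@_0%MM * q@_0%MM.
Proof. exact: rmorphM. Qed.

Lemma expansion_poly p : expansion (tofrac p) (fun d => trunc d p).
Proof.
exists p, 1; split; first by rewrite mcoeff1 eqxx oner_neq0.
  by rewrite tofrac1 divr1.
by move=> d; rewrite rmorph1 mul1r.
Qed.

Lemma expansionM f1 f2 g1 g2 : expansion f1 g1 -> expansion f2 g2 ->
  expansion (f1 * f2) (fun d => g1 d * g2 d).
Proof.
move=> [P1 [D1 [n1 -> E1]]] [P2 [D2 [n2 -> E2]]]; exists (P1 * P2), (D1 * D2).
split; first by rewrite mcoeff0M mulf_neq0.
  by rewrite !tofracM mulf_div.
by move=> d; rewrite !rmorphM mulrACA E1 E2.
Qed.

Lemma expansionD f1 f2 g1 g2 : expansion f1 g1 -> expansion f2 g2 ->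
  expansion (f1 + f2) (fun d => g1 d + g2 d).
Proof.
move=> [P1 [D1 [n1 -> E1]]] [P2 [D2 [n2 -> E2]]].
exists (P1 * D2 + P2 * D1), (D1 * D2).
split; first by rewrite mcoeff0M mulf_neq0.
  by rewrite tofracD !tofracM addf_div ?tofrac_neq0.
by move=> d; rewrite rmorphD !rmorphM -E1 -E2; ring.
Qed.

Lemma expansion1 : expansion 1 (fun d => 1).
Proof.
exists 1, 1; split; first by rewrite mcoeff1 eqxx oner_neq0.
  by rewrite tofrac1 divr1.
by move=> d; rewrite rmorph1 mul1r.
Qed.

Lemma expansionX f g k :
  expansion f g -> expansion (f ^+ k) (fun d => g d ^+ k).
Proof.
move=> fg; elim: k => [|k IH]; first exact: expansion1.
have [P [D [n E H]]] := expansionM fg IH; exists P, D; split=> //.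
  by rewrite exprS.
by move=> d; rewrite exprS.
Qed.

Lemma expansion_prod (I : Type) (r : seq I) (f : I -> ratfun v) g :
    (forall i, expansion (f i) (g i)) ->
  expansion (\prod_(i <- r) f i) (fun d => \prod_(i <- r) g i d).
Proof.
move=> fg; elim: r => [|i r IH].
  have [P [D [n E H]]] := expansion1; exists P, D.
  by split=> [||d]; rewrite ?big_nil.
have [P [D [n E H]]] := expansionM (fg i) IH; exists P, D; split=> //.
  by rewrite big_cons.
by move=> d; rewrite big_cons.
Qed.

(** Modulo positive degree, [g2 0 = 1] says that the power series of f2 has
    constant term 1, so that a numerator of f2 is an admissible denominator. *)
Lemma expansion_div f1 f2 g1 g2 g : expansion f1 g1 -> expansion f2 g2 ->
  g2 0%N = 1 -> (forall d, g d * g2 d = g1 d) -> expansion (f1 / f2) g.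
Proof.
move=> [P1 [D1 [n1 -> E1]]] [P2 [D2 [n2 -> E2]]] g20 gE.
have P20 : P2@_0%MM != 0.
  have := E2 0%N; rewrite g20 mulr1 => /(iffRL (@truncP _ _ _)) <- //.
  by rewrite mdeg0.
exists (P1 * D2), (D1 * P2); split; first by rewrite mcoeff0M mulf_neq0.
  by rewrite invf_div mulf_div !tofracM.
by move=> d; rewrite !rmorphM -E1 -gE -E2; ring.
Qed.

(** The coefficient of a monomial m in the Cauchy product only involves degrees
    at most that of m, so the truncation at d = mdeg m decides it. *)
Lemma expansion_expands_to f g (S : series v) (T : nat -> {mpoly rat[v]}) :
  expansion f g -> (forall d, g d = trunc d (T d)) ->
  (forall d m, (mdeg m <= d)%N -> (T d)@_m = S m) -> expands_to f S.
Proof.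
move=> [P [D [n -> E]]] gT TS; exists P, D; split=> // m.
have := E (mdeg m); rewrite gT -rmorphM => /(iffRL (@truncP _ _ _)) <- //.
rewrite mcoeffM; apply: eq_bigr => k /eqP mE; rewrite (TS _ k.2) //.
exact: leq_mdeg_addr mE.
Qed.

End Truncation.

Arguments trunc {v} d.

(** * The triangular system and the exchange relation *)

Section TriangularSystem.

Variables (A : comNzRingType) (h : {rmorphism rat -> A}) (d : nat).
Variables (z : nat -> A) (b : nat -> nat -> int).

(** The solution of Y_m = z_m prod_(l < m) (1 + Y_l)^b(m, l); [fuel] bounds the
    depth of this strong recursion. *)
Fixpoint yhat_fuel (fuel m : nat) : A :=
  if fuel is fuel'.+1
  then z m * \prod_(1 <= l < m) pow1p h d (yhat_fuel fuel' l) (b m l)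
  else 0.

Definition yhat m := yhat_fuel m.+1 m.

Lemma yhat_fuel_stable k l m : (m < k)%N -> (m < l)%N ->
  yhat_fuel k m = yhat_fuel l m.
Proof.
elim: k l m => // k IH [|l] m // mk ml /=; congr (_ * _).
by apply: eq_big_nat => i /andP[_ im]; rewrite (IH l) //; lia.
Qed.

Lemma yhat_rec m : yhat m = z m * \prod_(1 <= l < m) pow1p h d (yhat l) (b m l).
Proof.
rewrite {1}/yhat /=; congr (_ * _); apply: eq_big_nat => i /andP[_ im].
by rewrite /yhat (@yhat_fuel_stable _ i.+1).
Qed.

Hypothesis z_nil : forall m, (0 < m)%N -> z m ^+ d.+1 = 0.

Lemma yhat_nil m : (0 < m)%N -> yhat m ^+ d.+1 = 0.
Proof. by move=> m0; rewrite yhat_rec exprMn z_nil // mul0r. Qed.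

End TriangularSystem.

Section Solution.

Variables (v : nat) (hv : (0 < v)%N) (N : arrows 'I_v).
Hypothesis hN : symmetric_quiver hv N.

Local Notation sz := (s hv N).

Definition twist (y x : nat) : int :=
  - sz (y%:Z - x%:Z) + s' hv N (y%:Z - x%:Z).

Lemma twist_diag m : twist m m = -1.
Proof. by rewrite /twist subrr s_0 s'_0. Qed.

Section Abstract.

Variables (A : comNzRingType) (h : {rmorphism rat -> A}) (d : nat).
Variable z : nat -> A.
Hypothesis z_nil : forall m, (0 < m)%N -> z m ^+ d.+1 = 0.

Local Notation Y := (yhat h d z twist).
Local Notation pw m a := (pow1p h d (Y m) a).

(** The solution prod_m (1 + Y_m)^s_(n-m) of the exchange relations, with
    n = q + 1 - v as for [mut_label].  Factors with m > n are 1, so any large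
    enough upper bound on m gives the same product. *)
Definition label_expansion (q : nat) : A :=
  \prod_(1 <= l < q.+2) pw l (sz (q.+1%:Z - v%:Z - l%:Z)).

Lemma label_expansion_bound T q : (0 < T)%N -> (q.+1 < T + v)%N ->
  label_expansion q = \prod_(1 <= l < T) pw l (sz (q.+1%:Z - v%:Z - l%:Z)).
Proof.
move=> T0 Tq.
have one l : (q.+1 < l + v)%N -> pw l (sz (q.+1%:Z - v%:Z - l%:Z)) = 1.
  by move=> ql; rewrite s_neg ?pow1p_0 //; lia.
rewrite /label_expansion; have [Tq2|Tq2] := leqP T q.+2.
  rewrite (big_cat_nat (n := T)) //= [X in _ * X]big_nat.
  rewrite [X in _ * X]big1 ?mulr1 //.
  by move=> l lT; rewrite one //; lia.
rewrite [RHS](big_cat_nat (n := q.+2)) //=; last by lia.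
rewrite [X in _ * X]big_nat [X in _ * X]big1 ?mulr1 //.
by move=> l lT; rewrite one //; lia.
Qed.

Lemma label_expansion_init q : (q < v)%N -> label_expansion q = 1.
Proof. by move=> qv; rewrite (@label_expansion_bound 1) ?big_geq. Qed.

Lemma prod_label_expansion t (c : 'I_v -> nat) :
  \prod_(j < v) label_expansion (t + j) ^+ c j =
  \prod_(1 <= l < t.+1)
    pw l (\sum_(j < v) (c j)%:Z * sz (t.+1%:Z - l%:Z - v%:Z + j%:Z)).
Proof.
rewrite (eq_bigr (fun j : 'I_v => \prod_(1 <= l < t.+1)
    pw l ((c j)%:Z * sz (t.+1%:Z - l%:Z - v%:Z + j%:Z)))).
  rewrite exchange_big /=; apply: eq_big_nat => l /andP[l0 _].
  by rewrite pow1p_sum // yhat_nil.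
have jv (j : 'I_v) := ltn_ord j.
move=> j _; rewrite (@label_expansion_bound t.+1) //; last by have := jv j; lia.
rewrite -prodrXl; apply: eq_big_nat => l /andP[l0 _].
rewrite pow1p_M ?yhat_nil //; congr (pow1p _ _ _ (sz _) ^+ _); lia.
Qed.

(** Write G for [label_expansion] and count vertices from 1.  Comparing exponents
    of 1 + Y_l for l <= t, the recursion of s gives
    prod_j G(t+j)^N(1->j+1) = G(t+v) G(t) / (1 + Y_(t+1)), and the definition of
    s' says that this product times Y_(t+1) is z_(t+1) times the product over
    the incoming arrows. *)
Lemma label_expansion_exchange t :
  label_expansion (t + v) * label_expansion t =
    z t.+1 * \prod_(j < v) label_expansion (t + j) ^+ N j (Ordinal hv)
    + \prod_(j < v) label_expansion (t + j) ^+ N (Ordinal hv) j.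
Proof.
have Ynil l : (0 < l)%N -> Y l ^+ d.+1 = 0 by exact: yhat_nil.
have Eout : \prod_(j < v) label_expansion (t + j) ^+ N (Ordinal hv) j =
    \prod_(1 <= l < t.+1) pw l (sz (t.+1%:Z - l%:Z)) * label_expansion t.
  rewrite prod_label_expansion (@label_expansion_bound t.+1) //; last by lia.
  rewrite -big_split; apply: eq_big_nat => l /andP[l0 lt] /=.
  rewrite sum_out //; last by lia.
  by rewrite pow1p_D ?Ynil //; congr (_ * pow1p _ _ _ (sz _)); lia.
have Ein : z t.+1 * \prod_(j < v) label_expansion (t + j) ^+ N j (Ordinal hv) =
    Y t.+1 * \prod_(j < v) label_expansion (t + j) ^+ N (Ordinal hv) j.
  rewrite yhat_rec -mulrA; congr (_ * _).
  rewrite !prod_label_expansion -big_split; apply: eq_big_nat => l /andP[l0 lt].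
  rewrite /= sum_in // sum_out //; last by lia.
  by rewrite -pow1p_D ?Ynil // /twist; congr pow1p; ring.
rewrite Ein Eout (@label_expansion_bound t.+2 (t + v)); [|by []|by lia].
rewrite big_nat_recr //= (_ : _ - _ - _ = 0); last by lia.
rewrite s_0 pow1p_1 ?Ynil //.
rewrite (eq_big_nat _ _ (F2 := fun l => pw l (sz (t.+1%:Z - l%:Z)))).
  by ring.
by move=> l _; congr (pow1p _ _ _ (sz _)); lia.
Qed.

Lemma label_expansion_words n : (0 < n)%N ->
  label_expansion (n.-1 + v) =
    \sum_(w <- words d n) h (coef_term hv N n w) * \prod_(x <- w) z x.
Proof.
case: n => // n _; rewrite (@label_expansion_bound n.+2); [|by []|by lia].
transitivity (\prod_(1 <= l < n.+2) pw l (sz (n.+1%:Z - l%:Z))).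
  by apply: eq_big_nat => l _; congr (pow1p _ _ _ (sz _)); lia.
exact: (prod_pow1p_expand (yhat_nil h _ z_nil) (yhat_rec h d z twist)
                          twist_diag).
Qed.

End Abstract.

(** * The sum over words *)

Definition ymon (x : nat) : 'X_{1..v} :=
  [multinom `|sz (x%:Z - i.+1%:Z)|%N | i < v].

Definition word_mon (w : seq nat) : 'X_{1..v} := (\sum_(x <- w) ymon x)%MM.

Lemma expo_term_word_mon w i : expo_term hv N w i = (word_mon w i)%:Z.
Proof.
rewrite /expo_term /word_mon mnm_sumE (big_morph Posz PoszD (erefl _)).
by apply: eq_bigr => x _; rewrite mnmE gez0_abs ?(s_ge0 hN).
Qed.

Lemma mdeg_ymon x : (0 < x)%N -> (0 < mdeg (ymon x))%N.
Proof.
case: x => // x _; have [i si] := s_window_neq0 hN x.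
rewrite lt0n mdeg_eq0; apply/eqP => /(congr1 (fun m : 'X_{1..v} => m i)).
rewrite mnmE mnm0E (_ : _ - _ = x%:Z - i%:Z); last by lia.
by move: si; lia.
Qed.

(** Every letter contributes at least one variable, so only finitely many words
    have a given monomial. *)
Lemma size_le_mdeg n w : in_W n w -> (size w <= mdeg (word_mon w))%N.
Proof.
move=> /andP[_]; rewrite /word_mon.
elim: w => // x w IH /= /andP[/andP[x0 _] /IH].
by rewrite big_cons mdegD; have := mdeg_ymon x0; lia.
Qed.

Definition trunc_ymon d (m : nat) : truncated v d := trunc d 'X_[ymon m].

Lemma trunc_ymon_nil d m : (0 < m)%N -> trunc_ymon d m ^+ d.+1 = 0.
Proof.
move=> m0; rewrite /trunc_ymon -rmorphXn -[RHS](rmorph0 (@trunc v d)).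
apply/truncP => k kd; rewrite mcoeffXn mcoeff0; case: eqP => // kE.
by move: kd; rewrite -kE mdegMn; have := mdeg_ymon m0; nia.
Qed.

Local Notation Gt d q :=
  (@label_expansion (truncated v d) (trunc_const v d) d (@trunc_ymon d) q).

Lemma Gt_0 q : Gt 0 q = 1.
Proof.
rewrite /label_expansion big1 // => l _.
by rewrite /pow1p big_nat1 gbin0 rmorph1 mulr1.
Qed.

(** Both sides satisfy the same exchange relation and start from 1; the relation
    is solved for the new label, dividing by one of constant term 1. *)
Lemma mut_label_expansion q : expansion (mut_label hv N q) (fun d => Gt d q).
Proof.
elim/ltn_ind: q => q IH; have [qv|vq] := ltnP q v.
  have [P [D [n E H]]] := expansion1 v; exists P, D; split=> //.
    by rewrite /mut_label qv.
  by move=> d; rewrite label_expansion_init.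
have {vq} [t qE] : exists t, q = (t + v)%N by exists (q - v)%N; lia.
rewrite {}qE in IH *; rewrite (mut_label_exchange hN).
have IHj (j : 'I_v) :
    expansion (mut_label hv N (t + j)) (fun d => Gt d (t + j)).
  by apply: IH; rewrite ltn_add2l.
have IHt : expansion (mut_label hv N t) (fun d => Gt d t) by apply: IH; lia.
apply: (expansion_div
    (g1 := fun d =>
       trunc_ymon d t.+1 * \prod_(j < v) Gt d (t + j) ^+ N j (Ordinal hv)
       + \prod_(j < v) Gt d (t + j) ^+ N (Ordinal hv) j)
    _ IHt (Gt_0 t)); last first.
  by move=> d; apply: label_expansion_exchange; exact: trunc_ymon_nil.
apply: expansionD; last first.
  by apply: expansion_prod => j; apply: expansionX.
apply: expansionM; last by apply: expansion_prod => j; apply: expansionX.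
rewrite (_ : \prod_(i < v) _ = tofrac ('X_[ymon t.+1] : {mpoly rat[v]})).
  exact: expansion_poly.
rewrite mpolyXE_id rmorph_prod; apply: eq_bigr => i _ /=.
rewrite rmorphXn mnmE; congr (_ ^+ `|sz _|)%N; lia.
Qed.

Definition word_poly d n : {mpoly rat[v]} :=
  \sum_(w <- words d n) coef_term hv N n w *: 'X_[word_mon w].

Lemma Gt_word_poly d n : (0 < n)%N -> Gt d (n.-1 + v) = trunc d (word_poly d n).
Proof.
move=> n0; rewrite (label_expansion_words _ (@trunc_ymon_nil d)) //.
rewrite /word_poly rmorph_sum.
apply: eq_bigr => w _; rewrite truncZ /word_mon.
rewrite (big_morph (fun m => 'X_[m]) (@mpolyXD v rat) (mpolyX0 _ _)).
by rewrite rmorph_prod.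
Qed.

Definition word_series n : series v := fun m => (word_poly (mdeg m) n)@_m.

(** For d at least the degree of m, this lists all words in W with monomial m:
    the bound d on multiplicities excludes none of them. *)
Definition words_of_mon d n m : seq (seq nat) :=
  [seq w <- words d n | word_mon w == m].

Lemma mem_words_of_mon d n m w : (mdeg m <= d)%N ->
  (w \in words_of_mon d n m) = in_W n w && (word_mon w == m).
Proof.
move=> md; rewrite mem_filter andbC; case: eqP => [wm|]; last by rewrite !andbF.
rewrite !andbT; apply/idP/idP => [/words_in_W //|wW].
by apply: in_W_words => //; rewrite (leq_trans (size_le_mdeg wW)) ?wm.
Qed.

Lemma mcoeff_word_poly d n m :
  (word_poly d n)@_m = \sum_(w <- words_of_mon d n m) coef_term hv N n w.
Proof.
rewrite /word_poly raddf_sum /= big_filter [RHS]big_mkcond /=.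
apply: eq_bigr => w _; rewrite mcoeffZ mcoeffX.
by case: eqP; rewrite ?mulr1 ?mulr0.
Qed.

Lemma mcoeff_word_poly_stable d n m : (mdeg m <= d)%N ->
  (word_poly d n)@_m = word_series n m.
Proof.
move=> md; rewrite /word_series !mcoeff_word_poly.
apply: perm_big; apply: uniq_perm.
- by rewrite filter_uniq ?words_uniq.
- by rewrite filter_uniq ?words_uniq.
by move=> w; rewrite !mem_words_of_mon.
Qed.

Lemma word_series_sum n :
  is_series_sum (in_W n) (coef_term hv N n) (expo_term hv N) (word_series n).
Proof.
split=> [w _ i|m]; first by rewrite expo_term_word_mon.
exists (words_of_mon (mdeg m) n m); split; last exact: mcoeff_word_poly.
  by rewrite filter_uniq ?words_uniq.
move=> w; rewrite mem_words_of_mon //; congr (_ && _).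
apply/eqP/forallP => [<- i|wm]; first by rewrite expo_term_word_mon.
by apply/mnmP => i; have := wm i; rewrite expo_term_word_mon => /eqP[].
Qed.

End Solution.

Theorem theorem4p3 (v : nat) (hv : (0 < v)%N) (N : arrows 'I_v)
    (hN : symmetric_quiver hv N) (n : nat) (hn : (1 <= n)%N) :
  exists S : series v,
    is_series_sum (in_W n) (coef_term hv N n) (expo_term hv N) S /\
    expands_to (Fpoly hv N n) S.
Proof.
exists (word_series hv N n); split; first exact: word_series_sum.
rewrite Fpoly_mut_label //.
apply: expansion_expands_to (mut_label_expansion hN _) _ _.
  by move=> d; apply: Gt_word_poly.
by move=> d m md; apply: mcoeff_word_poly_stable.
Qed.
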